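(* For all integers $n \geq 3$, $B_1(C_n)=2$ if $n=2^k$ for some positive integer $k$, and $B_1(C_n)=3$ otherwise. Moreover, if $n \neq 2^k$ for every positive integer $k$, then $\mathrm{Spec}(C_n, 1)=\{2,3\}$ if $n$ is even and $\mathrm{Spec}(C_n, 1)=\{3\}$ if $n$ is odd.
   Context: $C_n$ is the cycle with vertex set $\mathbb{Z}_n=\{0,1,\dots,n-1\}$, $i$ adjacent to $i\pm1 \pmod n$; the graph distance is $\mathrm{dist}(i,j)=\min(|i-j|,\,n-|i-j|)$, and the set of positive distances realized is $\{1,\dots,\lfloor n/2\rfloor\}$. For a set $D$ of positive integers, the distance graph $G(C_n,D)$ has vertex set $\mathbb{Z}_n$, with distinct $i,j$ adjacent iff $\mathrm{dist}(i,j)\in D$; $\chi(C_n,D)$ is its chromatic number. $B_k(C_n)=\max\{\chi(C_n,D): D\subseteq\{1,\dots,\lfloor n/2\rfloor\},\ |D|=k\}$ and $\mathrm{Spec}(C_n,k)=\{\chi(C_n,D): D\subseteq\{1,\dots,\lfloor n/2\rfloor\},\ |D|=k\}$. *)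

(* Defs.v *)
From HB Require Import structures.
From mathcomp Require Import all_boot all_order all_algebra.
From mathcomp Require Import finmap zify.

Set Implicit Arguments.
Unset Strict Implicit.
Unset Printing Implicit Defensive.

Import IntDist.

Record sgraph := SGraph {
  vertex :> finType;
  edge : rel vertex;
  edge_sym : symmetric edge;
  edge_irrefl : irreflexive edge
}.

Definition colorable (G : sgraph) (k : nat) : bool :=
  [exists f : {ffun G -> 'I_k},
    [forall x, forall y, edge x y ==> (f x != f y)]].

Lemma colorable_ex (G : sgraph) : exists k, colorable G k.
Proof.
exists #|G|; apply/existsP; exists [ffun x => enum_rank x].
apply/forallP => x; apply/forallP => y; apply/implyP => xy.
rewrite !ffunE (inj_eq enum_rank_inj).
by apply: contraTneq xy => ->; rewrite edge_irrefl.
Qed.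

Definition chromatic (G : sgraph) : nat := ex_minn (colorable_ex G).

(* Here `|i - j| is the absolute difference of two naturals, so the outer
   subtraction is never truncated. *)
Definition cdist (n : nat) (i j : 'I_n) : nat :=
  minn `|i - j| (n - `|i - j|).

Definition cycle_adj (n : nat) : rel 'I_n :=
  [rel i j : 'I_n | (j == i.+1 %[mod n]) || (i == j.+1 %[mod n])].

Lemma cdistC (n : nat) (i j : 'I_n) : cdist i j = cdist j i.
Proof. by rewrite /cdist distnC. Qed.

Lemma cdist_adj (n : nat) (i j k : 'I_n) :
  cycle_adj i j -> cdist i k <= (cdist j k).+1.
Proof.
case: i j k => [i hi] [j hj] [k hk]; rewrite /cycle_adj /cdist /=.
rewrite (modn_small hi) (modn_small hj).
have md (a : nat) : a < n -> a.+1 %% n = if a.+1 == n then 0 else a.+1.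
  by move=> ha; case: eqP => [->|ne]; [rewrite modnn | rewrite modn_small; lia].
rewrite !md //; do 2 case: ifP; lia.
Qed.

Lemma cdist_step (n : nat) (i k : 'I_n) :
  0 < cdist i k -> exists2 j, cycle_adj i j & cdist i k = (cdist j k).+1.
Proof.
case: i k => [i hi] [k hk]; rewrite /cycle_adj /cdist /= => d0.
have md (a : nat) : a < n -> a.+1 %% n = if a.+1 == n then 0 else a.+1.
  by move=> ha; case: eqP => [->|ne]; [rewrite modnn | rewrite modn_small; lia].
have up : (i.+1 %% n) < n by rewrite ltn_mod; lia.
have dn : (if i is i'.+1 then i' else n.-1) < n by case: (i) hi => *; lia.
have [le|gt] := leqP (minn `|(i.+1 %% n) - k| (n - `|(i.+1 %% n) - k|)).+1
                     (minn `|i - k| (n - `|i - k|)).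
  exists (Ordinal up) => /=; first by rewrite modn_mod eqxx.
  by move: le; rewrite md //; case: ifP; lia.
exists (Ordinal dn) => /=; last first.
  by move: gt; rewrite md //; case: ifP; case: (i) hi d0 {up dn}; lia.
apply/orP; right; case: (i) hi => [|i'] hi //=.
by rewrite prednK // modnn mod0n.
Qed.

(* cdist is the length of a shortest path of the cycle. *)
Lemma cdist_shortest (n : nat) (i j : 'I_n) :
  (exists p, [/\ path (@cycle_adj n) i p, last i p = j & size p = cdist i j])
  /\ (forall p, path (@cycle_adj n) i p -> last i p = j -> cdist i j <= size p).
Proof.
split.
  move: {2}(cdist i j) (erefl (cdist i j)) => d.
  elim: d i => [|d IH] i Ed.
    exists [::]; rewrite Ed; split=> //=; apply/val_inj => /=.
    by move: Ed (ltn_ord i) (ltn_ord j); rewrite /cdist; lia.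
  have [|k ik Ek] := @cdist_step n i j; first by rewrite Ed.
  have [|p [pp pl ps]] := IH k; first by lia.
  by exists (k :: p); rewrite /= ik pp Ek ps.
move=> p; elim: p i => [|k p IH] i /=; first by move=> _ ->; rewrite /cdist; lia.
by move=> /andP[ik pp] pl; apply: leq_trans (cdist_adj j ik) _; apply: IH.
Qed.

Definition dist_edge (n : nat) (D : {pred nat}) : rel 'I_n :=
  [rel i j : 'I_n | (i != j) && (cdist i j \in D)].

Lemma dist_edge_sym (n : nat) (D : {pred nat}) : symmetric (@dist_edge n D).
Proof. by move=> i j; rewrite /dist_edge /= eq_sym cdistC. Qed.

Lemma dist_edge_irrefl (n : nat) (D : {pred nat}) :
  irreflexive (@dist_edge n D).
Proof. by move=> i; rewrite /dist_edge /= eqxx. Qed.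

Definition dist_graph (n : nat) (D : {pred nat}) : sgraph :=
  SGraph (@dist_edge_sym n D) (@dist_edge_irrefl n D).

Definition chi (n : nat) (D : {fset nat}) : nat :=
  chromatic (dist_graph n (mem D)).

Local Open Scope fset_scope.

Definition dist_range (n : nat) : {fset nat} := [fset d in iota 1 (n %/ 2)].

Definition dist_sets (n k : nat) : {fset {fset nat}} :=
  [fset D in fpowerset (dist_range n) | #|` D| == k].

(* The junk value 0 occurs only when k > n %/ 2, so that there is no D. *)
Definition B (k n : nat) : nat :=
  \max_(D <- dist_sets n k) chi n D.

Definition Spec (n k : nat) : {fset nat} :=
  [fset chi n D | D in dist_sets n k].

Lemma in_dist_sets (n k : nat) (D : {fset nat}) :
  (D \in dist_sets n k) =
  [forall d : D, 1 <= val d <= n %/ 2] && (#|` D| == k).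
Proof.
rewrite !inE /= fpowersetE; congr (_ && _).
apply/fsubsetP/forallP => [sD d | sD d dD].
  by have := sD _ (valP d); rewrite !inE /= mem_iota; lia.
by have := sD [` dD]; rewrite !inE /= mem_iota; lia.
Qed.

(* Main.v *)
Require Import Defs.
From mathcomp Require Import all_boot finmap.
From mathcomp Require Import zify.

(** A single distance [d] with [1 <= d <= n/2] joins [i] to [i + d] and [i - d]
    modulo [n], so the distance graph is a disjoint union of cycles of length
    [m = n / gcd(n, d)] (single edges when [m = 2]).  When [m] is even, [d / gcd(n, d)]
    is odd and the parity of [i / gcd(n, d)] is a proper 2-colouring; when [m]
    is odd, walking by steps of [d] from [0] gives a closed walk of odd length.
    Three colours are always enough: give colour 2 to the last [d] vertices and
    alternate colours 0 and 1 on the successive blocks of length [d] of the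
    other vertices.  The theorem follows by taking for [d] either [n/2] or the
    2-part of [n]. *)

Lemma colorableP (G : sgraph) (k : nat) :
  reflect (exists f : G -> 'I_k, forall x y, edge x y -> f x != f y)
          (colorable G k).
Proof.
apply: (iffP existsP) => [[f /forallP fP]|[f fP]].
  by exists f => x y xy; have /forallP/(_ y)/implyP := fP x; apply.
exists (finfun f); apply/forallP => x; apply/forallP => y; apply/implyP => xy.
by rewrite !ffunE; apply: fP.
Qed.

Lemma colorable_monotone (G : sgraph) (k l : nat) :
  k <= l -> colorable G k -> colorable G l.
Proof.
move=> le_kl /colorableP[f fP]; apply/colorableP.
exists (fun x => widen_ord le_kl (f x)) => x y /fP.
by apply: contraNneq => /(congr1 val) /= fxy; apply/eqP/val_inj.
Qed.

Lemma chromatic_eqS (G : sgraph) (k : nat) :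
  colorable G k.+1 -> ~~ colorable G k -> chromatic G = k.+1.
Proof.
move=> ck nck; rewrite /chromatic; case: ex_minnP => m cm min_m.
apply/eqP; rewrite eqn_leq min_m //= ltnNge.
by apply: contra nck => /colorable_monotone; apply.
Qed.

Section SingleDistance.

Variables n d : nat.
Hypotheses (d_gt0 : 0 < d) (d_le : d <= n %/ 2).

Let G := dist_graph n (mem [fset d]%fset).

(** The two residues [i + d] and [i - d] modulo [n], each with or without wrap-around, written
    additively to avoid truncated subtraction. *)
Lemma edge_dist1 (i j : 'I_n) : @edge G i j ->
  [\/ j = i + d :> nat, j + n = i + d,
      i = j + d :> nat | i + n = j + d].
Proof.
rewrite /= => /andP[_]; rewrite !inE /cdist => /eqP.
have := ltn_ord i; have := ltn_ord j => hj hi e.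
have : [|| j == i + d :> nat, j + n == i + d, i == j + d :> nat | i + n == j + d].
  by lia.
by case/or4P => /eqP ->; [apply: Or41|apply: Or42|apply: Or43|apply: Or44].
Qed.

Lemma edge_dist1_step (i j : 'I_n) : j = (i + d) %% n :> nat -> @edge G i j.
Proof.
move=> ej; have hi := ltn_ord i; have hj := ltn_ord j.
have {}ej : (j == i + d :> nat) || (j + n == i + d).
  have [lt_n|ge_n] := ltnP (i + d) n; first by rewrite ej modn_small // eqxx.
  apply/orP; right; rewrite ej -{1}(subnK ge_n) modnDr modn_small; lia.
apply/andP; split; last by rewrite !inE /cdist; lia.
by apply/eqP => /(congr1 val) /=; lia.
Qed.

(** Edges are symmetric, so only forward steps by [d] need checking: those staying below [n] and
    those wrapping around. *)
Lemma colorable_dist1 (k : nat) (c : nat -> nat) :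
  (forall x, c x < k) ->
  (forall x, x + d < n -> c x != c (x + d)) ->
  (forall x y, x < n -> y + n = x + d -> c x != c y) ->
  colorable G k.
Proof.
move=> ck c_step c_wrap; apply/colorableP.
exists (fun x : G => Ordinal (ck (val (x : 'I_n)))) => x y xy; rewrite -val_eqE /=.
have hx := ltn_ord x; have hy := ltn_ord y.
case: (edge_dist1 _ _ xy) => e.
- by rewrite e c_step // -e.
- exact: c_wrap.
- by rewrite e eq_sym c_step // -e.
- by rewrite eq_sym c_wrap.
Qed.

Lemma colorable3_dist1 : colorable G 3.
Proof.
apply: (@colorable_dist1 3
  (fun x => if n - d <= x then 2 else (odd (x %/ d) : nat))).
- by move=> x; case: ifP => // _; case: odd.
- move=> x lt_n; rewrite ifN; last by lia.
  rewrite divnDr // divnn d_gt0 addn1 oddS.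
  by case: ifP => _; case: odd.
(* A wrapping step starts among the last [d] vertices and lands at [y < d <= n - d], outside
   them. *)
- move=> x y lt_n e; rewrite ifT; last by lia.
  by rewrite ifN; [case: odd | lia].
Qed.

Lemma colorable1_dist1 : ~~ colorable G 1.
Proof.
have n_gt0 : 0 < n by lia.
apply/colorableP => -[f fP].
have /fP : @edge G (Ordinal n_gt0) (Ordinal (ltn_pmod d n_gt0)).
  exact: edge_dist1_step.
by rewrite !ord1.
Qed.

Lemma colorable2_dist1 : colorable G 2 = ~~ odd (n %/ gcdn n d).
Proof.
have n_gt0 : 0 < n by lia.
set g := gcdn n d; set m := n %/ g.
have g_gt0 : 0 < g by rewrite gcdn_gt0 n_gt0.
have En : n = m * g by rewrite divnK // dvdn_gcdl.
have Ed : d = d %/ g * g by rewrite divnK // dvdn_gcdr.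
apply/idP/idP => [/colorableP[f fP]|m_even].
  pose w k : G := Ordinal (ltn_pmod (k * d) n_gt0).
  (* With two colours, each step of the walk must swap them. *)
  have w_alt k : (f (w k) == f (w 0) :> nat) = ~~ odd k.
    elim: k => [|k IH]; first by rewrite eqxx.
    have /fP : @edge G (w k) (w k.+1).
      by apply: edge_dist1_step; rewrite /= modnDml mulSn addnC.
    move: IH; rewrite -val_eqE /=.
    by case: (f (w k)) (f (w k.+1)) (f (w 0)) => [a ?] [b ?] [c ?] /=; lia.
  rewrite -w_alt; have -> // : w m = w 0.
  by apply/val_inj; rewrite /= Ed mulnCA -En mod0n modnMl.
(* [m] and [d %/ g] are coprime, so they cannot both be even. *)
have e_odd : odd (d %/ g).
  have : coprime m (d %/ g).
    by rewrite /coprime -(eqn_pmul2r g_gt0) muln_gcdl -En -Ed mul1n.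
  apply: contraTT => e_even; rewrite /coprime.
  have : 2 %| gcdn m (d %/ g) by rewrite dvdn_gcd !dvdn2 m_even.
  by case: eqP => // ->.
have parity x : odd ((x + d) %/ g) = ~~ odd (x %/ g).
  by rewrite Ed addnC divnMDl // oddD e_odd.
apply: (@colorable_dist1 2 (fun x => odd (x %/ g))).
- by move=> x; case: odd.
(* A wrap shifts the quotient by [g] by the even number [m], so parity still flips there. *)
- by move=> x _; rewrite parity; case: odd.
- move=> x y _ e; have := parity x.
  rewrite -e {1}En addnC divnMDl // oddD (negbTE m_even) /= => ->.
  by case: odd.
Qed.

Lemma chi_dist1 : chi n [fset d]%fset = if odd (n %/ gcdn n d) then 3 else 2.
Proof.
have := colorable2_dist1; case: odd => c2; apply: chromatic_eqS.
- exact: colorable3_dist1.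
- by rewrite c2.
- by rewrite c2.
- exact: colorable1_dist1.
Qed.

End SingleDistance.

Lemma dist_sets1P (n : nat) (D : {fset nat}) :
  reflect (exists2 d, 0 < d <= n %/ 2 & D = [fset d]%fset) (D \in dist_sets n 1).
Proof.
rewrite in_dist_sets.
apply: (iffP andP) => [[/forallP hD /cardfs1P[d eD]]|[d hd ->]].
  have dD : d \in D by rewrite eD inE.
  by exists d => //; exact: hD [` dD]%fset.
split; last by rewrite cardfs1.
by apply/forallP => -[x /= hx]; move: hx; rewrite inE => /eqP ->.
Qed.

Lemma SpecP1 (n c : nat) :
  reflect (exists2 d, 0 < d <= n %/ 2
                    & c = if odd (n %/ gcdn n d) then 3 else 2)
          (c \in Spec n 1).
Proof.
apply: (iffP (imfsetP _ _ _ _)) => [[D /= /dist_sets1P[d hd ->] ->]|[d hd ->]].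
  by exists d => //; case/andP: hd => d0 d1; rewrite chi_dist1.
exists [fset d]%fset; first by apply/dist_sets1P; exists d.
by case/andP: hd => d0 d1; rewrite chi_dist1.
Qed.

Lemma B_max_Spec (n k c : nat) :
  c \in Spec n k -> (forall x, x \in Spec n k -> x <= c) -> B k n = c.
Proof.
move=> /imfsetP[D /= hD ->] ub; apply/eqP; rewrite eqn_leq; apply/andP; split.
  by apply/bigmax_leqP_seq => D' hD' _; apply: ub; apply: in_imfset.
by rewrite leq_bigmax_seq.
Qed.

Lemma Spec1_sub (n c : nat) : c \in Spec n 1 -> c = 2 \/ c = 3.
Proof. by case/SpecP1 => d _ ->; case: odd; [right | left]. Qed.

(** Every divisor of an odd [n] is odd, in particular [n %/ gcdn n d]. *)
Lemma Spec1_odd (n c : nat) : odd n -> c \in Spec n 1 -> c = 3.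
Proof.
move=> n_odd /SpecP1[d _ ->].
by rewrite (dvdn_odd _ n_odd) // dvdn_div ?dvdn_gcdl.
Qed.

Lemma Spec1_even_mem2 (n : nat) : 0 < n -> ~~ odd n -> 2 \in Spec n 1.
Proof.
(* For [d = n/2] the gcd is [d] itself and the quotient is 2. *)
move=> n_gt0 n_even; apply/SpecP1; exists (n %/ 2); first by lia.
have h : n %/ 2 * 2 = n by rewrite divnK // dvdn2.
rewrite (gcdn_idPr _); last by rewrite -{2}h dvdn_mulr.
by rewrite -{1}h mulKn //; lia.
Qed.

Lemma Spec1_mem3 (n : nat) :
  0 < n -> (forall k, n <> 2 ^ k) -> 3 \in Spec n 1.
Proof.
move=> n_gt0 n_pow; apply/SpecP1.
have [m co_m En] := @pfactor_coprime 2 n isT n_gt0.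
move: En; set p := 2 ^ logn 2 n => En.
have p_gt0 : 0 < p by rewrite expn_gt0.
rewrite coprime2n in co_m.
have m_neq1 : m <> 1 by move=> m1; apply: (n_pow (logn 2 n)); rewrite -/p En m1 mul1n.
(* The 2-part [p] leaves the odd quotient [m]; as [m] is not 1, it is at least 3, whence
   [p <= n/2]. *)
exists p.
  have : 2 * p <= m * p by rewrite leq_mul2r; lia.
  by rewrite -En; lia.
by rewrite (gcdn_idPr _) En ?dvdn_mull // mulnK // co_m.
Qed.

Lemma Spec1_pow2 (k c : nat) : c \in Spec (2 ^ k) 1 -> c = 2.
Proof.
move=> /SpecP1[d /andP[d_gt0 d_le] ->]; set g := gcdn _ _.
have g_gt0 : 0 < g by rewrite gcdn_gt0 d_gt0 orbT.
have Em : 2 ^ k %/ g * g = 2 ^ k by rewrite divnK // dvdn_gcdl.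
have g_le : g <= d by rewrite dvdn_leq // dvdn_gcdr.
have /(dvdn_pfactor _ _ (isT : prime 2))[j _ Ej] : 2 ^ k %/ g %| 2 ^ k.
  by rewrite dvdn_div ?dvdn_gcdl.
(* The quotient is [2 ^ j]; [j = 0] would give [g = 2 ^ k], against [g <= d <= 2 ^ k / 2]. *)
by rewrite Ej in Em *; case: j Em {Ej} => [|j]; rewrite ?oddX //; lia.
Qed.

Local Open Scope fset_scope.

Theorem theorem3p1p1 (n : nat) (hn : 3 <= n) :
  [/\ (exists2 k, 0 < k & n = 2 ^ k) -> B 1 n = 2,
      ~ (exists2 k, 0 < k & n = 2 ^ k) -> B 1 n = 3
    & (forall k, 0 < k -> n <> 2 ^ k) ->
      (~~ odd n -> Spec n 1 = [fset 2; 3]) /\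
      (odd n -> Spec n 1 = [fset 3])].
Proof.
have n_gt0 : 0 < n by lia.
have mem3 : (forall k, 0 < k -> n <> 2 ^ k) -> 3 \in Spec n 1.
  (* The exponent 0 would mean [n = 1], excluded by [3 <= n]. *)
  move=> npow; apply: Spec1_mem3 => // -[|k]; last exact: npow.
  by move=> n1; rewrite n1 in hn.
split.
- case=> -[//|k] _ En; apply: B_max_Spec.
    by apply: Spec1_even_mem2; rewrite // En oddX.
  by move=> c; rewrite En => /Spec1_pow2 ->.
- move=> npow; apply: B_max_Spec.
    by apply: mem3 => k k_gt0 En; apply: npow; exists k.
  by move=> c /Spec1_sub[] ->.
- move=> /mem3 {}mem3; split=> par; apply/fsetP => c; rewrite !inE.
    apply/idP/orP => [/Spec1_sub[] ->|[]/eqP-> //]; rewrite ?eqxx; [by left|by right|].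
    exact: Spec1_even_mem2.
  by apply/idP/eqP => [/(Spec1_odd _ _ par)|->].
Qed.
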